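(* The only perspective free Abelian group is $\mathbb{Z}$.
   Context: A free Abelian group is a direct sum of copies of the additive group of integers $\mathbb{Z}$. An Abelian group $G$ is called perspective if isomorphic direct summands of $G$ have a common direct complement: whenever $G=A\oplus H=B\oplus K$ with $A\cong B$, there exists a subgroup $C$ of $G$ with $G=A\oplus C=B\oplus C$. *)

(* Defs.v *)
From HB Require Import structures.
From mathcomp Require Import all_boot all_order all_algebra.
From mathcomp Require Import classical_sets functions.
From mathcomp.multinomials Require Import freeg.

Set Implicit Arguments.
Unset Strict Implicit.
Unset Printing Implicit Defensive.

Import GRing.Theory.

Local Open Scope classical_set_scope.
Local Open Scope ring_scope.

Definition isomorphic (U V : zmodType) : Prop :=
  exists f : {additive U -> V}, bijective f.

(* [{freeg I}] is the group of finite formal sums of elements of [I] with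
   coefficients in [int], that is, the direct sum of copies of Z indexed by [I].
   The index set may be infinite, or empty (in which case the group is zero). *)
Definition free_abelian (G : zmodType) : Prop :=
  exists I : choiceType, isomorphic G {freeg I}.

Section Perspective.
Context {G : zmodType}.
Implicit Types A B C H K : set G.

Definition subgroup A : Prop := GRing.zmod_closed [in A].

Definition direct_decomposition A H : Prop :=
  [/\ subgroup A, subgroup H, A `&` H = [set 0]
    & forall x, exists a h, [/\ A a, H h & x = a + h]].

(* Only the values of [f] on [A] matter. *)
Definition subgroup_isomorphic A B : Prop :=
  exists f : G -> G, {in A &, {morph f : x y / x + y}} /\ set_bij A B f.

End Perspective.

Definition perspective (G : zmodType) : Prop :=
  forall A H B K : set G,
    direct_decomposition A H -> direct_decomposition B K ->
    subgroup_isomorphic A B ->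
    exists C : set G, direct_decomposition A C /\ direct_decomposition B C.

(* Main.v *)
Require Import Defs.
From HB Require Import structures.
From mathcomp Require Import all_boot all_order all_algebra.
From mathcomp Require Import classical_sets functions.
From mathcomp.multinomials Require Import freeg.
From mathcomp Require Import boolp zify.

(** Inside Z, any two nonzero subgroups meet: [a] and [h] have the common
    multiple [a * h].  So one of the summands in a decomposition of Z is zero
    and the other is everything; isomorphic summands are then equal and any
    complement of one serves for both ([rank1_decomposition],
    [rank1_perspective]).

    Conversely, let two basis elements [a] and [b] of a free group be given.
    Then [a] and [2 a + 5 b] generate infinite cyclic summands: each is sent
    to 1 by some homomorphism to Z, and the kernel of that homomorphism is a
    complement.  Suppose [C] is a complement of both.  Modulo [C], the quotient
    is infinite cyclic generated by the class of [a], so [b] is there some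
    multiple [s a], and [2 a + 5 b] becomes [(2 + 5 s) a].  The latter must
    generate the quotient too, hence [2 + 5 s] is 1 or -1, which is impossible
    modulo 5 ([common_complement_unit], [rank2_not_perspective]).  A nonzero
    perspective free group therefore has a basis with exactly one element. *)

Set Implicit Arguments.
Unset Strict Implicit.
Unset Printing Implicit Defensive.

Import Order.TTheory GRing.Theory Num.Theory.

Local Open Scope classical_set_scope.
Local Open Scope ring_scope.

Lemma isomorphic_sym (U V : zmodType) : isomorphic U V -> isomorphic V U.
Proof.
case=> f [g fK gK].
pose gA : {additive V -> U} :=
  HB.pack g (GRing.isZmodMorphism.Build V U g (can2_zmod_morphism fK gK)).
by exists gA, f.
Qed.

Lemma isomorphic_trans (U V W : zmodType) :
  isomorphic U V -> isomorphic V W -> isomorphic U W.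
Proof. by move=> [f bij_f] [g bij_g]; exists (g \o f); apply: bij_comp. Qed.

Lemma freeg1_int (I : choiceType) (i : I) :
  (forall j, j = i) -> isomorphic {freeg I} int.
Proof.
move=> Ii; exists (coeff i); exists (fun n : int => << n *g i >>) => [D | n].
  by apply/eqP/freeg_eqP => j; rewrite /= (Ii j) coeffU eqxx mulr1.
by rewrite /= coeffU eqxx mulr1.
Qed.

Section Decompositions.
Context {G : zmodType}.
Implicit Types (A B C H K : set G) (a b x y : G).

Lemma subgroupP A :
  subgroup A <-> A 0 /\ forall x y, A x -> A y -> A (x - y).
Proof.
split=> [[/set_mem A0 AB] | [A0 AB]].
  by split=> // x y Ax Ay; apply/set_mem/AB; apply/mem_set.
by split=> [|x y /set_mem Ax /set_mem Ay]; apply/mem_set => //; apply: AB.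
Qed.

Lemma subgroup0 A : subgroup A -> A 0.
Proof. by case/subgroupP. Qed.

Lemma subgroupB A x y : subgroup A -> A x -> A y -> A (x - y).
Proof. by case/subgroupP => _; apply. Qed.

Lemma subgroupD A x y : subgroup A -> A x -> A y -> A (x + y).
Proof.
move=> sA Ax Ay; rewrite -[y]opprK -[- y]add0r.
by do 2!apply: subgroupB => //; apply: subgroup0.
Qed.

Lemma subgroupMz A x m : subgroup A -> A x -> A (x *~ m).
Proof.
move=> sA Ax; elim/int_rect: m => [|n IH|n IH]; first exact: subgroup0.
  by rewrite intS mulrzDr addrC; apply: subgroupD.
by rewrite intS opprD mulrzDr mulrN1z addrC; apply: subgroupB.
Qed.

Definition cyclic a : set G := range (fun m : int => a *~ m).

Lemma subgroup_cyclic a : subgroup (cyclic a).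
Proof.
apply/subgroupP; split; first by exists 0.
by move=> _ _ [m _ <-] [n _ <-]; exists (m - n); rewrite ?mulrzBr.
Qed.

(** Such an [f] splits the inclusion of [cyclic a]: [x] has the component
    [a *~ f x] in it. *)
Lemma decomposition_cyclic_ker (f : {additive G -> int}) a :
  f a = 1 -> direct_decomposition (cyclic a) [set x | f x = 0].
Proof.
move=> fa; split.
- exact: subgroup_cyclic.
- apply/subgroupP; split=> [|x y /= fx fy]; first exact: raddf0.
  by rewrite raddfB fx fy subr0.
- apply/seteqP; split=> [_ [[m _ <-] /=] | _ ->].
    by rewrite raddfMz fa intz => ->.
  by split; [exists 0 | rewrite /= raddf0].
- move=> x; exists (a *~ f x), (x - a *~ f x); split; first by exists (f x).
    by rewrite /= raddfB raddfMz fa intz subrr.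
  by rewrite addrC subrK.
Qed.

(** The homomorphisms serve twice: [f] makes [a *~ m |-> b *~ m] well
    defined, as [x |-> b *~ f x], and [g] makes it injective. *)
Lemma cyclic_isomorphic (f g : {additive G -> int}) a b :
  f a = 1 -> g b = 1 -> subgroup_isomorphic (cyclic a) (cyclic b).
Proof.
move=> fa gb; exists (fun x => b *~ f x); split; last split.
- by move=> x y _ _; rewrite raddfD mulrzDr.
- by move=> x _; exists (f x).
- move=> _ _ /set_mem[m _ <-] /set_mem[n _ <-].
  by move/(congr1 g); rewrite !raddfMz fa gb !intz => ->.
- move=> _ [m _ <-]; exists (a *~ m); first by exists m.
  by rewrite raddfMz fa intz.
Qed.

(** Modulo [C] the group is infinite cyclic on the class of [a]; if [b] is
    congruent to [a *~ s], the other summand is generated by the class of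
    [a *~ (p + s * q)], which must again be a generator.  The proof does this
    with elements, without forming the quotient. *)
Lemma common_complement_unit (f : {additive G -> int}) a b (p q : int) C :
  f a = 1 -> direct_decomposition (cyclic a) C ->
  direct_decomposition (cyclic (a *~ p + b *~ q)) C ->
  exists s, p + s * q \is a GRing.unit.
Proof.
move=> fa [_ sC AC GA] [_ _ _ GB].
have [_ [c [[s _ <-] Cc b_eq]]] := GA b.
have [_ [d [[m _ <-] Cd a_eq]]] := GB a.
exists s; set u := p + s * q.
(* The component of a along the second summand is congruent to a *~ (u * m),
   so the difference lies both in C and in cyclic a. *)
have C_a : C (a *~ (1 - u * m)).
  have -> : a *~ (1 - u * m) = c *~ (q * m) + d.
    have a_sum : a = a *~ (u * m) + (c *~ (q * m) + d).
      rewrite {1}a_eq b_eq mulrzDl -mulrzA addrA -mulrzDr mulrzDl -!mulrzA.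
      by rewrite -/u addrA.
    by rewrite mulrzBr mulr1z {1}a_sum addrC addKr.
  by apply: subgroupD => //; apply: subgroupMz.
have : [set 0] (a *~ (1 - u * m)) by rewrite -AC; split=> //; exists (1 - u * m).
move=> /(congr1 f); rewrite raddfMz fa intz raddf0 => /eqP.
by rewrite subr_eq0 eq_sym => /eqP um; apply/unitrPr; exists m.
Qed.

(** The hypotheses say that [a] and [b] freely generate a direct summand, on
    which [f] and [g] are the coordinates. *)
Lemma rank2_not_perspective (f g : {additive G -> int}) a b :
  f a = 1 -> f b = 0 -> g a = 0 -> g b = 1 -> ~ perspective G.
Proof.
move=> fa fb ga gb pG.
(* 2 and 5 are coprime, so a *~ 2 + b *~ 5 splits off (3 * 2 - 5 = 1), but 2 is
   not congruent to 1 or -1 modulo 5. *)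
pose h : {additive G -> int} := intmul (3 : int) \o f \- g.
have hab : h (a *~ 2 + b *~ 5) = 1.
  by rewrite raddfD !raddfMz /= fa fb ga gb.
have [C []] := pG _ _ _ _ (decomposition_cyclic_ker fa)
  (decomposition_cyclic_ker hab) (cyclic_isomorphic fa hab).
move=> dA /(common_complement_unit fa dA)[s].
by rewrite qualifE /=; lia.
Qed.

(** The group embeds in Z through [f], and two nonzero subgroups of Z always
    meet nontrivially. *)
Lemma rank1_decomposition (f : {additive G -> int}) A H :
  injective f -> direct_decomposition A H ->
  A = [set 0] /\ H = setT \/ A = setT /\ H = [set 0].
Proof.
move=> f_inj [sA sH AH GAH].
have [[a [Aa a0]] | A0] := pselect (exists a, A a /\ a <> 0).
  right.
  have H0 h : H h -> h = 0.
    move=> Hh.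
    (* In terms of images in Z, both sides are f a * f h. *)
    have ah : a *~ f h = h *~ f a.
      by apply: f_inj; rewrite !raddfMz mulrzz mulrzz mulrC.
    have : [set 0] (a *~ f h).
      by rewrite -AH; split; [|rewrite ah]; apply: subgroupMz.
    move=> /(congr1 f); rewrite raddfMz raddf0 mulrzz => /eqP.
    rewrite mulf_eq0 => /orP[] /eqP; rewrite -[RHS](raddf0 f) => /f_inj //.
  split; apply/seteqP; split=> // x.
  - by move=> _; have [y [h [Ay /H0-> ->]]] := GAH x; rewrite addr0.
  - by move=> ->; apply: subgroup0.
left.
have {}A0 a : A a -> a = 0.
  by move=> Aa; apply: contrapT => a0; apply: A0; exists a.
split; apply/seteqP; split=> // x.
- by move=> ->; apply: subgroup0.
- by move=> _; have [y [h [/A0-> Hh ->]]] := GAH x; rewrite add0r.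
Qed.

(** Isomorphic summands are equal here: if one is zero and the other everything,
    the bijection between them forces the group to be zero. *)
Lemma rank1_perspective (f : {additive G -> int}) :
  injective f -> perspective G.
Proof.
move=> f_inj A H B K dA dB [t [_ [tA t_inj tB]]].
suff AB : A = B by exists H; split=> //; rewrite -AB.
have [] := rank1_decomposition f_inj dA; have [] := rank1_decomposition f_inj dB;
  move=> [B_eq _] [A_eq _]; rewrite A_eq B_eq // in tA t_inj tB *.
- have t_const x : x = t 0 by have [_ ->] := tB x I.
  by apply/seteqP; split=> // x _; rewrite /= (t_const x) [RHS]t_const.
- apply/seteqP; split=> // x _; apply: t_inj; rewrite ?inE //.
  by rewrite (tA x) ?(tA 0).
Qed.

End Decompositions.

Theorem proposition3p13 (G : zmodType) :
  [/\ free_abelian G, exists x : G, x <> 0 & perspective G] <->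
  isomorphic G int.
Proof.
split=> [[[I [u bij_u]] [x x0] pG] | GZ].
  have [v uK vK] := bij_u.
  have [i _] : exists i, coeff i (u x) != 0.
    apply: contrapT => nz; apply: x0; apply: (bij_inj bij_u).
    rewrite raddf0; apply/eqP/freeg_eqP => i; rewrite coeff0.
    by apply: contrapT => /eqP ci; apply: nz; exists i.
  apply: (@isomorphic_trans _ {freeg I}); first by exists u.
  apply: (freeg1_int (i := i)) => j; apply: contrapT => /eqP ji.
  apply: (rank2_not_perspective (f := coeff i \o u) (g := coeff j \o u)
    (a := v << i >>) (b := v << j >>)) pG;
    by rewrite /= vK coeffU ?eqxx ?(eq_sym i) ?(negPf ji).
split.
- exists unit.
  apply: isomorphic_trans GZ _; apply: isomorphic_sym.
  by apply: (freeg1_int (i := tt)) => -[].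
- case: GZ => f [g fK gK]; exists (g 1) => g1.
  by have := gK 1; rewrite g1 raddf0.
- by case: GZ => f /bij_inj; apply: rank1_perspective.
Qed.
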